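(* Let $d\in\mathbb{N}$, let $\rho:\mathrm{Pol}(U_d^+)\to B(\mathbb{C})$ be a unital $^*$-representation, and let $\eta:\mathrm{Pol}(U_d^+)\to\mathbb{C}$ be a $\rho$-$\epsilon$-cocycle. Put $V=(\eta(u_{jk}))_{j,k=1}^d$ and $W=(\eta(u_{jk}^* ))_{j,k=1}^d$ in $M_d(\mathbb{C})$. Then $\eta$ admits a generating functional if and only if $\bar WW^t=VV^*$. In particular, a Gaussian cocycle $\eta:\mathrm{Pol}(U_d^+)\to\mathbb{C}$ admits a generating functional if and only if $VV^*=V^*V$.
   Context: $\mathrm{Pol}(U_d^+)$ is the universal unital $^*$-algebra generated by $u_{jk}$, $1\le j,k\le d$, subject to $uu^*=u^*u=I$ and $\bar uu^t=u^t\bar u=I$, where $u=(u_{jk})$, $\bar u=(u_{jk}^* )$, $u^t=(u_{kj})$. Its character $\epsilon$ is the unital $^*$-homomorphism to $\mathbb{C}$ with $\epsilon(u_{jk})=\delta_{jk}$. A $\rho$-$\epsilon$-cocycle (with values in $\mathbb{C}$) is a linear map $\eta$ with $\eta(ab)=\rho(a)\eta(b)+\eta(a)\epsilon(b)$ for all $a,b$; it is Gaussian if $\rho=\epsilon$. The cocycle $\eta$ admits a generating functional if there is a linear functional $\psi:\mathrm{Pol}(U_d^+)\to\mathbb{C}$ with $\psi(ab)=\psi(a)\epsilon(b)+\epsilon(a)\psi(b)+\overline{\eta(a^* )}\,\eta(b)$ for all $a,b$. For $X\in M_d(\mathbb{C})$, $\bar X$ is the entrywise conjugate, $X^t$ the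 transpose, $X^*$ the conjugate transpose. *)

(* Defs.v *)
From HB Require Import structures.
From mathcomp Require Import all_boot all_order all_algebra.
From mathcomp Require Import boolp reals complex.
Set Implicit Arguments.
Unset Strict Implicit.
Unset Printing Implicit Defensive.
Import Order.TTheory GRing.Theory Num.Theory.
Local Open Scope ring_scope.
Local Open Scope quotient_scope.

HB.mixin Record Algebra_isStar (C : numClosedFieldType) A
    of GRing.Algebra C A := {
  star : A -> A;
  starK : involutive star;
  starD : {morph star : a b / a + b};
  starZ : forall (c : C) (a : A), star (c *: a) = c^* *: star a;
  starM : forall a b : A, star (a * b) = star b * star a
}.

#[short(type="starAlgType")]
HB.structure Definition StarAlgebra (C : numClosedFieldType) :=
  {A of Algebra_isStar C A & GRing.Algebra C A}.

Section RegularStar.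
Variable C : numClosedFieldType.

Let conjZ (c : C) (a : C^o) : (c *: a)^* = c^* *: (a^* : C^o) :> C^o.
Proof. exact: rmorphM. Qed.

Let conjMC (a b : C^o) : (a * b)^* = b^* * a^* :> C^o.
Proof. by rewrite rmorphM mulrC. Qed.

HB.instance Definition _ := Algebra_isStar.Build C C^o
  (@conjCK C) (fun a b => rmorphD (@Num.conj C) a b) conjZ conjMC.
End RegularStar.

(* u u^* = u^* u = I and \bar u u^t = u^t \bar u = I, where \bar u is the
   entrywise adjoint and u^* = \bar u^t. *)
Definition biunitary (C : numClosedFieldType) (B : starAlgType C) (d : nat)
    (u : 'M[B]_d) : Prop :=
  let ubar := map_mx star u in
  [/\ u *m ubar^T = 1%:M, ubar^T *m u = 1%:M,
      ubar *m u^T = 1%:M & u^T *m ubar = 1%:M].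

Section PolU.
Variables (C : numClosedFieldType) (d : nat).

(* Formal *-algebra expressions in d * d generators; [Econst c] stands for
   the multiple c of the unit. *)
Inductive expr :=
  | Egen of 'I_d & 'I_d
  | Econst of C
  | Eadd of expr & expr
  | Emul of expr & expr
  | Estar of expr.

HB.instance Definition _ := gen_eqMixin expr.
HB.instance Definition _ := gen_choiceMixin expr.

Fixpoint eval (B : starAlgType C) (v : 'M[B]_d) (t : expr) : B :=
  match t with
  | Egen j k => v j k
  | Econst c => c%:A
  | Eadd s t => eval v s + eval v t
  | Emul s t => eval v s * eval v t
  | Estar t => star (eval v t)
  end.

(* Pol(U_d^+) is the quotient of the expressions by the identities that hold
   for every biunitary matrix over every unital *-algebra; see [polU_biunitary]
   and [polU_universal] below for the defining universal property. *)
Definition expr_eqv : rel expr := fun s t =>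
  `[< forall (B : starAlgType C) (v : 'M[B]_d),
        biunitary v -> eval v s = eval v t >].

Lemma expr_eqv_refl : reflexive expr_eqv.
Proof. by move=> t; apply/asboolP. Qed.

Lemma expr_eqv_sym : symmetric expr_eqv.
Proof.
by move=> s t; apply/asboolP/asboolP => st B v hv; rewrite (st B v hv).
Qed.

Lemma expr_eqv_trans : transitive expr_eqv.
Proof.
move=> t s r /asboolP st /asboolP tr; apply/asboolP => B v hv.
by rewrite (st B v hv) (tr B v hv).
Qed.

Canonical expr_eqv_equiv :=
  EquivRel expr_eqv expr_eqv_refl expr_eqv_sym expr_eqv_trans.

Definition polU := {eq_quot expr_eqv}.

HB.instance Definition _ := Choice.on polU.

Definition polU_eval (B : starAlgType C) (v : 'M[B]_d) (a : polU) : B :=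
  eval v (repr a).

Lemma polU_eval_pi (B : starAlgType C) (v : 'M[B]_d) (hv : biunitary v) t :
  polU_eval v (\pi_polU t) = eval v t.
Proof.
have /eqmodP/asboolP : repr (\pi_polU t) = t %[mod polU] by rewrite reprK.
exact.
Qed.

Lemma polU_evalP (a b : polU) :
  (forall (B : starAlgType C) (v : 'M[B]_d),
     biunitary v -> polU_eval v a = polU_eval v b) -> a = b.
Proof.
by move=> ab; rewrite -[a]reprK -[b]reprK; apply/eqmodP/asboolP.
Qed.

Definition polU_const c : polU := \pi_polU (Econst c).
Definition polU_add (a b : polU) : polU := \pi_polU (Eadd (repr a) (repr b)).
Definition polU_mul (a b : polU) : polU := \pi_polU (Emul (repr a) (repr b)).
Definition polU_opp (a : polU) : polU := polU_mul (polU_const (-1)) a.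
Definition polU_scale (c : C) (a : polU) : polU := polU_mul (polU_const c) a.
Definition polU_adj (a : polU) : polU := \pi_polU (Estar (repr a)).

Section EvalOps.
Variables (B : starAlgType C) (v : 'M[B]_d) (hv : biunitary v).
Local Notation ev := (polU_eval v).
Lemma polU_eval_const c : ev (polU_const c) = c%:A.
Proof. by rewrite polU_eval_pi. Qed.
Lemma polU_eval_add a b : ev (polU_add a b) = ev a + ev b.
Proof. by rewrite polU_eval_pi. Qed.
Lemma polU_eval_mul a b : ev (polU_mul a b) = ev a * ev b.
Proof. by rewrite polU_eval_pi. Qed.
Lemma polU_eval_opp a : ev (polU_opp a) = - ev a.
Proof. by rewrite polU_eval_mul polU_eval_const scaleN1r mulN1r. Qed.
Lemma polU_eval_scale c a : ev (polU_scale c a) = c *: ev a.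
Proof. by rewrite polU_eval_mul polU_eval_const mulr_algl. Qed.
Lemma polU_eval_adj a : ev (polU_adj a) = star (ev a).
Proof. by rewrite polU_eval_pi. Qed.
Definition polU_evalE :=
  (polU_eval_const, polU_eval_add, polU_eval_opp,
   polU_eval_scale, polU_eval_mul, polU_eval_adj).
End EvalOps.

Lemma polU_addA : associative polU_add.
Proof.
by move=> a b c; apply: polU_evalP => B v hv; rewrite !polU_evalE ?addrA.
Qed.
Lemma polU_addC : commutative polU_add.
Proof.
by move=> a b; apply: polU_evalP => B v hv; rewrite !polU_evalE // addrC.
Qed.
Lemma polU_add0 : left_id (polU_const 0) polU_add.
Proof.
by move=> a; apply: polU_evalP => B v hv; rewrite !polU_evalE // scale0r add0r.
Qed.
Lemma polU_addN : left_inverse (polU_const 0) polU_opp polU_add.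
Proof.
by move=> a; apply: polU_evalP => B v hv; rewrite !polU_evalE // scale0r addNr.
Qed.
HB.instance Definition _ :=
  GRing.isZmodule.Build polU polU_addA polU_addC polU_add0 polU_addN.

Lemma polU_mulA : associative polU_mul.
Proof.
by move=> a b c; apply: polU_evalP => B v hv; rewrite !polU_evalE ?mulrA.
Qed.
Lemma polU_mul1l : left_id (polU_const 1) polU_mul.
Proof.
by move=> a; apply: polU_evalP => B v hv; rewrite !polU_evalE // scale1r mul1r.
Qed.
Lemma polU_mul1r : right_id (polU_const 1) polU_mul.
Proof.
by move=> a; apply: polU_evalP => B v hv; rewrite !polU_evalE // scale1r mulr1.
Qed.
Lemma polU_mulDl : left_distributive polU_mul polU_add.
Proof.
by move=> a b c; apply: polU_evalP => B v hv; rewrite !polU_evalE // mulrDl.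
Qed.
Lemma polU_mulDr : right_distributive polU_mul polU_add.
Proof.
by move=> a b c; apply: polU_evalP => B v hv; rewrite !polU_evalE // mulrDr.
Qed.

Lemma biunitary1 : biunitary (1%:M : 'M[C^o]_d).
Proof.
have s1 : map_mx star (1%:M : 'M[C^o]_d) = 1%:M.
  by apply/matrixP => i j; rewrite !mxE; exact: rmorph_nat.
by split; rewrite s1 !trmx1 mulmx1.
Qed.

Lemma polU_one_neq0 : polU_const 1 != polU_const 0.
Proof.
apply/eqP => /(congr1 (polU_eval (1%:M : 'M[C^o]_d))).
rewrite !(polU_evalE biunitary1) scale1r scale0r => /eqP.
by rewrite oner_eq0.
Qed.
HB.instance Definition _ :=
  GRing.Zmodule_isNzRing.Build polU
    polU_mulA polU_mul1l polU_mul1r polU_mulDl polU_mulDr polU_one_neq0.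

Lemma polU_scaleA a b u : polU_scale a (polU_scale b u) = polU_scale (a * b) u.
Proof. by apply: polU_evalP => B v hv; rewrite !polU_evalE // scalerA. Qed.
Lemma polU_scale1 : left_id 1 polU_scale.
Proof.
by move=> a; apply: polU_evalP => B v hv; rewrite !polU_evalE // scale1r.
Qed.
Lemma polU_scaleDr : right_distributive polU_scale +%R.
Proof.
by move=> c a b; apply: polU_evalP => B v hv; rewrite !polU_evalE // scalerDr.
Qed.
Lemma polU_scaleDl u : {morph polU_scale^~ u : a b / a + b}.
Proof.
by move=> a b; apply: polU_evalP => B v hv; rewrite !polU_evalE // scalerDl.
Qed.
HB.instance Definition _ :=
  GRing.Zmodule_isLmodule.Build C polU
    polU_scaleA polU_scale1 polU_scaleDr polU_scaleDl.

Lemma polU_scaleAl (c : C) (a b : polU) : c *: (a * b) = c *: a * b.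
Proof. by apply: polU_evalP => B v hv; rewrite !polU_evalE // scalerAl. Qed.
HB.instance Definition _ := GRing.Lmodule_isLalgebra.Build C polU polU_scaleAl.

Lemma polU_scaleAr (c : C) (a b : polU) : c *: (a * b) = a * (c *: b).
Proof. by apply: polU_evalP => B v hv; rewrite !polU_evalE // scalerAr. Qed.
HB.instance Definition _ := GRing.Lalgebra_isAlgebra.Build C polU polU_scaleAr.

Lemma polU_adjK : involutive polU_adj.
Proof.
by move=> a; apply: polU_evalP => B v hv; rewrite !polU_evalE // starK.
Qed.
Lemma polU_adjD : {morph polU_adj : a b / a + b}.
Proof.
by move=> a b; apply: polU_evalP => B v hv; rewrite !polU_evalE // starD.
Qed.
Lemma polU_adjZ (c : C) (a : polU) : polU_adj (c *: a) = c^* *: polU_adj a.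
Proof. by apply: polU_evalP => B v hv; rewrite !polU_evalE // starZ. Qed.
Lemma polU_adjM (a b : polU) : polU_adj (a * b) = polU_adj b * polU_adj a.
Proof. by apply: polU_evalP => B v hv; rewrite !polU_evalE // starM. Qed.
HB.instance Definition _ :=
  Algebra_isStar.Build C polU polU_adjK polU_adjD polU_adjZ polU_adjM.

Definition polU_gen : 'M[polU]_d := \matrix_(j, k) \pi_polU (Egen j k).

End PolU.

Definition star_morphism (C : numClosedFieldType) (A B : starAlgType C)
    (f : A -> B) : Prop :=
  forall a : A, f (star a) = star (f a).

Section Universal.
Variables (C : numClosedFieldType) (d : nat).
Local Notation polU := (polU C d).
Local Notation u := (polU_gen C d).

Section Lift.
Variables (B : starAlgType C) (v : 'M[B]_d) (hv : biunitary v).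

Lemma polU_eval_gen j k : polU_eval v (u j k) = v j k.
Proof. by rewrite mxE polU_eval_pi. Qed.

Lemma polU_eval_star : star_morphism (polU_eval v : polU -> B).
Proof. by move=> a; rewrite polU_evalE. Qed.

Lemma polU_eval_is_linear : linear (polU_eval v : polU -> B).
Proof. by move=> c a b; rewrite !polU_evalE. Qed.

Lemma polU_eval_is_monoid_morphism :
  monoid_morphism (polU_eval v : polU -> B).
Proof.
by split=> [|a b]; rewrite polU_evalE // scale1r.
Qed.

Definition polU_lift_fun of biunitary v := polU_eval v : polU -> B.

HB.instance Definition _ := GRing.isLinear.Build C polU B *:%R
  (polU_lift_fun hv) polU_eval_is_linear.
HB.instance Definition _ := GRing.isMonoidMorphism.Build polU B
  (polU_lift_fun hv) polU_eval_is_monoid_morphism.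

Definition polU_lift : {lrmorphism polU -> B} := polU_lift_fun hv.

End Lift.

Lemma polU_biunitary : biunitary u.
Proof.
have sumE (B : starAlgType C) (v : 'M[B]_d) (hv : biunitary v)
    (F : 'I_d -> polU) :
    polU_eval v (\sum_k F k) = \sum_k polU_eval v (F k).
  exact: (raddf_sum (polU_lift hv)).
have natE (B : starAlgType C) (v : 'M[B]_d) (hv : biunitary v) n :
    polU_eval v (n%:R : polU) = n%:R.
  exact: (rmorph_nat (polU_lift hv)).
by split; apply/matrixP => i j; apply: polU_evalP => B v hv;
  case: (hv) => h1 h2 h3 h4;
  rewrite !mxE sumE // natE //;
  [move/matrixP/(_ i j): h1 | move/matrixP/(_ i j): h2
  |move/matrixP/(_ i j): h3 | move/matrixP/(_ i j): h4];
  rewrite !mxE => <-; apply: eq_bigr => k _;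
  rewrite [LHS](polU_evalE hv) !mxE ?(polU_evalE hv) !polU_eval_pi.
Qed.

Lemma polU_universal (B : starAlgType C) (v : 'M[B]_d) : biunitary v ->
  exists! f : polU -> B,
    [/\ linear f, monoid_morphism f, star_morphism f
      & forall j k, f (u j k) = v j k].
Proof.
move=> hv; exists (polU_eval v : polU -> B); split.
  split; [exact: polU_eval_is_linear | exact: polU_eval_is_monoid_morphism
         | exact: polU_eval_star | exact: polU_eval_gen].
move=> f [flin [f1 fM] fstar fu]; apply/funext => a; apply/esym.
have fD x y : f (x + y) = f x + f y by rewrite -[x in LHS]scale1r flin scale1r.
have f0 : f 0 = 0 by apply: (addrI (f 0)); rewrite -fD !addr0.
have fZ c x : f (c *: x) = c *: f x by rewrite -[c *: x]addr0 flin f0 addr0.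
rewrite -[a]reprK polU_eval_pi //; elim: (repr a) => {a}
  [j k|c|s IHs t IHt|s IHs t IHt|t IHt] /=.
- by rewrite -fu mxE.
- rewrite -f1 -fZ; congr f.
  by apply: polU_evalP => B' v' hv'; rewrite !polU_evalE // scale1r.
- rewrite -IHs -IHt -fD; congr f.
  by apply: polU_evalP => B' v' hv'; rewrite !polU_evalE // !polU_eval_pi.
- rewrite -IHs -IHt -fM; congr f.
  by apply: polU_evalP => B' v' hv'; rewrite !polU_evalE // !polU_eval_pi.
- rewrite -IHt -fstar; congr f.
  by apply: polU_evalP => B' v' hv'; rewrite !polU_evalE // !polU_eval_pi.
Qed.

Definition counit : {lrmorphism polU -> C^o} := polU_lift (biunitary1 C d).

Lemma counit_gen j k : counit (u j k) = (j == k)%:R.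
Proof. by rewrite [LHS](polU_eval_gen (biunitary1 C d)) mxE. Qed.

Lemma counit_star : star_morphism counit.
Proof. exact: (polU_eval_star (biunitary1 C d)). Qed.

(* B(C) is identified with C acting on itself by multiplication, so that a
   unital *-representation on C is a unital *-homomorphism to C. *)
Definition cocycle (rho : {lrmorphism polU -> C^o})
    (eta : {linear polU -> C^o}) : Prop :=
  forall a b : polU, eta (a * b) = rho a * eta b + eta a * counit b.

Definition gaussian_cocycle (eta : {linear polU -> C^o}) : Prop :=
  cocycle counit eta.

Definition admits_generating_functional (eta : {linear polU -> C^o}) : Prop :=
  exists psi : {linear polU -> C^o}, forall a b : polU,
    psi (a * b) = psi a * counit b + counit a * psi b
                  + (eta (star a))^* * eta b.

End Universal.

(* Main.v *)
(** Write [U], [V], [W] for the matrices with entries [rho (u j k)],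
    [eta (u j k)], [eta (star (u j k))], and [bar], [t], [H] for conjugate,
    transpose and adjoint.  The cocycle identity applied to the four defining
    relations gives [W^t = - U^H V = - V U^H].  If [psi] exists, applying it to
    [u u^H = I] and [ubar u^t = I] yields two expressions, [Wbar W^t] and
    [V V^H], for the same matrix up to transposition.  Conversely, a hermitian
    [psi] is the same thing as a unital homomorphism
      [a |-> [[eps a, (eta (star a))^*, psi a], [0, rho a, eta a], [0, 0, eps a]]]
    respecting stars when 3x3 matrices are conjugated and reflected in the
    antidiagonal.  By the universal property it suffices to prescribe
    [psi u = - V V^H / 2] and to check that the resulting matrix over the 3x3
    matrices is biunitary. *)
Require Import Defs.
From HB Require Import structures.
From mathcomp Require Import all_boot all_order all_algebra.
From mathcomp Require Import boolp reals complex.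
Import GRing.Theory Num.Theory.
Local Open Scope ring_scope.
Local Open Scope quotient_scope.

(** * An involution on square matrices that preserves upper triangularity *)

Section AntidiagonalStar.
Variables (C : numClosedFieldType) (n : nat).
Local Notation M := 'M[C]_n.+1.

(** With [J] the order-reversing permutation matrix and [H] the adjoint, this is [J A^H J], the
    adjoint for an indefinite hermitian form; the ordinary adjoint would turn upper into lower
    triangular matrices. *)
Definition antistar (A : M) : M :=
  \matrix_(i, j) (A (rev_ord j) (rev_ord i))^*.

Lemma antistarK : involutive antistar.
Proof. by move=> A; apply/matrixP => i j; rewrite !mxE conjCK !rev_ordK. Qed.

Lemma antistarD : {morph antistar : A B / A + B}.
Proof. by move=> A B; apply/matrixP => i j; rewrite !mxE rmorphD. Qed.

Lemma antistarZ (c : C) (A : M) : antistar (c *: A) = c^* *: antistar A.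
Proof. by apply/matrixP => i j; rewrite !mxE rmorphM. Qed.

Lemma antistarM (A B : M) : antistar (A * B) = antistar B * antistar A.
Proof.
apply/matrixP => i j; rewrite !mxE rmorph_sum (reindex_inj rev_ord_inj).
by apply: eq_bigr => k _; rewrite !mxE rmorphM mulrC.
Qed.

HB.instance Definition _ :=
  Algebra_isStar.Build C M antistarK antistarD antistarZ antistarM.

End AntidiagonalStar.

(** * Triangular 3x3 matrices and biunitary matrices over them *)

Section TriangularMatrices.
Variable C : numClosedFieldType.

(** The outer diagonal entries share [e] because both will be values of the counit. The defaults of
    [nth] are never reached. *)
Definition tri3 (e b p r c : C) : 'M[C]_3 :=
  \matrix_(i, j) nth 0 (nth [::] [:: [:: e; b; p]; [:: 0; r; c]; [:: 0; 0; e]]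
                            i) j.

Lemma tri3M e b p r c e' b' p' r' c' :
  tri3 e b p r c * tri3 e' b' p' r' c' =
  tri3 (e * e') (e * b' + b * r') (e * p' + b * c' + p * e')
       (r * r') (r * c' + c * e').
Proof.
apply/matrixP => i j; rewrite mxE !big_ord_recl big_ord0 !mxE.
by case: i j => [[|[|[|//]]] ?] [[|[|[|//]]] ?] /=;
  rewrite ?(mulr0, mul0r, addr0, add0r, addrA).
Qed.

Lemma tri3D e b p r c e' b' p' r' c' :
  tri3 e b p r c + tri3 e' b' p' r' c' =
  tri3 (e + e') (b + b') (p + p') (r + r') (c + c').
Proof.
apply/matrixP => i j; rewrite !mxE.
by case: i j => [[|[|[|//]]] ?] [[|[|[|//]]] ?] /=; rewrite ?addr0.
Qed.

Lemma tri3_scalar a : tri3 a 0 0 a 0 = a%:A.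
Proof.
apply/matrixP => i j; rewrite !mxE.
by case: i j => [[|[|[|//]]] ?] [[|[|[|//]]] ?] /=; rewrite ?mulr1 ?mulr0.
Qed.

Lemma star_tri3 e b p r c :
  star (tri3 e b p r c) = tri3 e^* c^* p^* r^* b^*.
Proof.
apply/matrixP => i j; rewrite !mxE.
by case: i j => [[|[|[|//]]] ?] [[|[|[|//]]] ?] /=; rewrite ?conjC0.
Qed.

Lemma tri3_sum (I : Type) (s : seq I) (e b p r c : I -> C) :
  \sum_(k <- s) tri3 (e k) (b k) (p k) (r k) (c k) =
  tri3 (\sum_(k <- s) e k) (\sum_(k <- s) b k) (\sum_(k <- s) p k)
       (\sum_(k <- s) r k) (\sum_(k <- s) c k).
Proof.
elim: s => [|k s IHs]; first by rewrite !big_nil tri3_scalar scale0r.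
by rewrite !big_cons IHs tri3D.
Qed.

Variable d : nat.

(** The identity is built into the outer diagonal since the counit sends both [u] and its entrywise
    star to it. Transposing this matrix moves the 3x3 entries without transposing them. *)
Definition tri_mx (b p r c : 'M[C]_d) : 'M['M[C]_3]_d :=
  \matrix_(j, k) tri3 (1%:M j k) (b j k) (p j k) (r j k) (c j k).

Lemma mul_tri_mx b p r c b' p' r' c' :
  tri_mx b p r c *m tri_mx b' p' r' c' =
  tri_mx (b' + b *m r') (p' + b *m c' + p) (r *m r') (r *m c' + c).
Proof.
apply/matrixP => i j; set e : 'M[C]_d := 1%:M.
(* Writing out the identity factors makes each entry a sum over the same inner index, so that
   [tri3_sum] and [tri3M] apply termwise. *)
transitivity (tri3 ((e *m e) i j) ((e *m b' + b *m r') i j)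
    ((e *m p' + b *m c' + p *m e) i j) ((r *m r') i j)
    ((r *m c' + c *m e) i j)); last by rewrite [RHS]mxE /e !(mul1mx, mulmx1).
rewrite !mxE -!big_split -tri3_sum.
by apply: eq_bigr => k _; rewrite /tri_mx [in LHS]mxE [X in _ * X]mxE tri3M.
Qed.

Lemma tr_tri_mx b p r c : (tri_mx b p r c)^T = tri_mx b^T p^T r^T c^T.
Proof. by apply/matrixP => i j; rewrite !mxE eq_sym. Qed.

Lemma star_tri_mx b p r c :
  map_mx star (tri_mx b p r c) =
  tri_mx (map_mx Num.conj c) (map_mx Num.conj p) (map_mx Num.conj r)
         (map_mx Num.conj b).
Proof.
apply/matrixP => i j; rewrite [LHS]mxE.
by rewrite ![tri_mx _ _ _ _ _ _]mxE star_tri3 !mxE conjC_nat.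
Qed.

Lemma tri_mx1 : tri_mx 0 0 1%:M 0 = 1%:M.
Proof.
apply/matrixP => i j; rewrite !mxE tri3_scalar.
by case: (i == j); rewrite ?scale1r ?scale0r.
Qed.

Local Notation "A ^bar" := (map_mx Num.conj A) (at level 2, format "A ^bar").

Lemma bar_barK (A : 'M[C]_d) : A^bar^bar = A.
Proof. by apply/matrixP => i j; rewrite !mxE conjCK. Qed.

(** Compared entry by entry, the relations reduce to unitarity of [U], to the four cocycle relations
    and their adjoints, and, in the corner, to [P + S + P = 0] or its transpose, as all four Gram
    matrices are [S] or [S^T]. *)
Lemma tri_mx_biunitary (U V W : 'M[C]_d) :
  [/\ U *m U^bar^T = 1%:M, U^bar^T *m U = 1%:M,
      U^bar *m U^T = 1%:M & U^T *m U^bar = 1%:M] ->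
  [/\ U *m W^T + V = 0, U^bar^T *m V + W^T = 0,
      U^bar *m V^T + W = 0 & U^T *m W + V^T = 0] ->
  W^bar *m W^T = V *m V^bar^T -> W^T *m W^bar = V *m V^bar^T ->
  V^bar^T *m V = V *m V^bar^T ->
  biunitary (tri_mx W^bar (- 2^-1 *: (V *m V^bar^T)) U V).
Proof.
move=> [U1 U2 U3 U4] [R1 R2 R3 R4] gramW1 gramW2 gramV.
set S := V *m V^bar^T in gramW1 gramW2 gramV *; set P := - 2^-1 *: S.
have SH : S^bar^T = S by rewrite /S map_mxM trmx_mul !map_trmx trmxK bar_barK.
have PH : P^bar^T = P.
  by rewrite /P map_mxZ linearZ /= SH rmorphN fmorphV rmorph_nat.
(* The factor [- 2^-1] makes [P] the hermitian solution of [P + S + P = 0]. *)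
have PbarE : P^bar = P^T by rewrite -[P in RHS]PH trmxK.
have PSP : P + S + P = 0.
  by rewrite addrAC -scalerDl -opprD -[2^-1]mul1r -splitr scaleN1r addNr.
have PSP' : P^T + S^T + P^T = 0 by rewrite -!linearD /= PSP linear0.
have ST1 : V^bar *m V^T = S^T by rewrite /S trmx_mul trmxK.
have ST2 : W^bar^T *m W = S^T by rewrite -gramW2 trmx_mul trmxK.
(* Adjoints of [R1] to [R4] settle the entries in the first row next to the diagonal. *)
have adj (A B D : 'M[C]_d) : A *m B + D = 0 -> D^bar^T + B^bar^T *m A^bar^T = 0.
  move=> /(congr1 (fun X : 'M_d => X^bar^T)).
  by rewrite map_mxD linearD /= map_mxM trmx_mul addrC map_mx0 trmx0.
rewrite /biunitary star_tri_mx !bar_barK !tr_tri_mx !mul_tri_mx -tri_mx1.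
rewrite PH PbarE U1 U2 U3 U4 R1 R2 R3 R4 gramW1 gramV ST1 ST2 PSP PSP'.
move/adj: R1; move/adj: R2; move/adj: R3; move/adj: R4.
by rewrite -!map_trmx !trmxK !bar_barK => -> -> -> ->.
Qed.

End TriangularMatrices.
Arguments tri3 {C}.
Arguments tri_mx {C d}.

(** * Induction on [polU], and the defining identities in matrix form *)

Section Cocycles.
Variables (C : numClosedFieldType) (d : nat).
Local Notation polU := (polU C d).
Local Notation u := (polU_gen C d).
Local Notation "A ^bar" := (map_mx Num.conj A) (at level 2, format "A ^bar").

(** Structural induction on a representative: the class of each constructor is the corresponding
    operation, as evaluation at every biunitary matrix shows. *)
Lemma polU_ind (P : polU -> Prop) :
  (forall j k, P (u j k)) -> (forall c : C, P (c%:A : polU)) ->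
  (forall a b, P a -> P b -> P (a + b)) ->
  (forall a b, P a -> P b -> P (a * b)) ->
  (forall a, P a -> P (star a)) ->
  forall a, P a.
Proof.
move=> Pu Pc PD PM Ps a; rewrite -[a]reprK; elim: (repr a) => {a}
  [j k|c|s Ps' t Pt|s Ps' t Pt|t Pt].
- by have := Pu j k; rewrite mxE.
- suff -> : \pi_polU (Econst d c) = c%:A :> polU by [].
  by apply: polU_evalP => B v hv; rewrite !polU_evalE // scale1r.
- suff -> : \pi_polU (Eadd s t) = (\pi_polU s : polU) + \pi_polU t by apply: PD.
  by apply: polU_evalP => B v hv; rewrite !polU_evalE // !polU_eval_pi.
- suff -> : \pi_polU (Emul s t) = (\pi_polU s : polU) * \pi_polU t by apply: PM.
  by apply: polU_evalP => B v hv; rewrite !polU_evalE // !polU_eval_pi.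
- suff -> : \pi_polU (Estar t) = star (\pi_polU t : polU) by apply: Ps.
  by apply: polU_evalP => B v hv; rewrite !polU_evalE // !polU_eval_pi.
Qed.

Lemma star1 (A : starAlgType C) : star 1 = 1 :> A.
Proof. by rewrite -[LHS]mulr1 -{2}[1]starK -starM mulr1 starK. Qed.

Lemma map_counit_gen : map_mx (counit C d) u = 1%:M :> 'M[C]_d.
Proof. by apply/matrixP => j k; rewrite [LHS]mxE counit_gen mxE. Qed.

Lemma map_counit_star_gen :
  map_mx (counit C d) (map_mx star u) = 1%:M :> 'M[C]_d.
Proof.
apply/matrixP => j k; rewrite [LHS]mxE [in LHS]mxE counit_star counit_gen mxE.
exact: conjC_nat.
Qed.

Lemma generating_functional_mulmx (eta psi : {linear polU -> C^o}) :
  (forall a b : polU, psi (a * b) = psi a * counit C d b + counit C d a * psi b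
                                    + (eta (star a))^* * eta b) ->
  forall A B : 'M[polU]_d,
    map_mx psi (A *m B) =
      map_mx psi A *m map_mx (counit C d) B + map_mx (counit C d) A *m map_mx psi B
      + (map_mx eta (map_mx star A))^bar *m map_mx eta B :> 'M[C]_d.
Proof.
move=> psiM A B; apply/matrixP => i j; rewrite !mxE raddf_sum -!big_split.
by apply: eq_bigr => k _; rewrite [LHS]psiM !mxE.
Qed.

(** * The criterion for a fixed representation and cocycle *)

Variables (rho : {lrmorphism polU -> C^o}) (eta : {linear polU -> C^o}).
Hypotheses (rho_star : star_morphism rho) (eta_cocycle : cocycle rho eta).

Local Notation U := (map_mx rho u : 'M[C]_d).
Local Notation V := (map_mx eta u : 'M[C]_d).
Local Notation W := (map_mx eta (map_mx star u) : 'M[C]_d).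

Lemma cocycle_mulmx (A B : 'M[polU]_d) :
  map_mx eta (A *m B) =
    map_mx rho A *m map_mx eta B + map_mx eta A *m map_mx (counit C d) B
    :> 'M[C]_d.
Proof.
apply/matrixP => i j; rewrite !mxE raddf_sum -big_split.
by apply: eq_bigr => k _; rewrite [LHS]eta_cocycle !mxE.
Qed.

Lemma cocycle1 : eta 1 = 0.
Proof.
have := eta_cocycle 1 1; rewrite mulr1 !rmorph1 mul1r mulr1 => eta11.
by apply: (addrI (eta 1)); rewrite addr0 -eta11.
Qed.

Lemma map_cocycle_scalar1 : map_mx eta 1%:M = 0 :> 'M[C]_d.
Proof.
apply/matrixP => i j; rewrite !mxE.
by case: (i == j); [exact: cocycle1 | exact: raddf0].
Qed.

Lemma map_rho_star (A : 'M[polU]_d) :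
  map_mx rho (map_mx star A) = (map_mx rho A : 'M[C]_d)^bar.
Proof. by apply/matrixP => i j; rewrite !mxE rho_star. Qed.

Lemma rho_unitary :
  [/\ U *m U^bar^T = 1%:M, U^bar^T *m U = 1%:M,
      U^bar *m U^T = 1%:M & U^T *m U^bar = 1%:M].
Proof.
have rhoM (A B : 'M[polU]_d) :
    map_mx rho A *m map_mx rho B = map_mx rho (A *m B) :> 'M[C]_d.
  by apply/esym; exact: map_mxM.
have rho1 : map_mx rho 1%:M = 1%:M :> 'M[C]_d by exact: map_mx1.
rewrite -map_rho_star; have := polU_biunitary C d.
rewrite /biunitary map_trmx => -[h1 h2 h3 h4].
by rewrite !map_trmx !rhoM h1 h2 h3 h4 rho1.
Qed.

Lemma cocycle_relations :
  [/\ U *m W^T + V = 0, U^bar^T *m V + W^T = 0,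
      U^bar *m V^T + W = 0 & U^T *m W + V^T = 0].
Proof.
have [h1 h2 h3 h4] := polU_biunitary C d.
split; rewrite -map_cocycle_scalar1.
- by rewrite -h1 cocycle_mulmx -!map_trmx map_counit_star_gen trmx1 mulmx1.
- by rewrite -h2 cocycle_mulmx -!map_trmx map_rho_star map_counit_gen mulmx1.
- by rewrite -h3 cocycle_mulmx -!map_trmx map_rho_star map_counit_gen trmx1 mulmx1.
- by rewrite -h4 cocycle_mulmx -!map_trmx map_counit_star_gen mulmx1.
Qed.

Lemma cocycle_starE : W = - (U^bar *m V^T) /\ W^T = - (U^bar^T *m V).
Proof.
have [_ h2 h3 _] := cocycle_relations.
by split; apply/eqP; rewrite -addr_eq0 addrC ?h2 ?h3.
Qed.

(** Substituting [W^T = - U^H V], or [W = - Ubar V^T], makes the unitary [U] cancel. Hence the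
    criterion amounts to normality of [V] for every [rho]. *)
Lemma gram_starE :
  W^bar *m W^T = V^bar^T *m V /\ W^T *m W^bar = V *m V^bar^T.
Proof.
have [U1 U2 _ _] := rho_unitary; have [WE WtE] := cocycle_starE.
have WbarE : W^bar = - (V^bar^T *m U).
  rewrite -[W]trmxK WtE [(- _)^T]linearN /= trmx_mul trmxK map_mxN map_mxM /=.
  by rewrite bar_barK -map_trmx.
split.
  rewrite WbarE WtE mulNmx mulmxN opprK mulmxA.
  by rewrite -[X in X *m _]mulmxA U1 mulmx1.
rewrite WE [(- _)^T]linearN /= trmx_mul trmxK map_mxN map_mxM /= bar_barK.
rewrite mulNmx mulmxN opprK mulmxA -[X in X *m _]mulmxA U2 mulmx1.
by rewrite -map_trmx.
Qed.

Lemma generating_functional_gram :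
  admits_generating_functional eta -> W^bar *m W^T = V *m V^bar^T.
Proof.
case=> psi psiM; have [h1 _ h3 _] := polU_biunitary C d.
have psiMM := generating_functional_mulmx _ _ psiM.
have starstar : map_mx star (map_mx star u) = u.
  by apply/matrixP => j k; rewrite [LHS]mxE [in LHS]mxE starK.
(* Symmetry of this matrix allows one expansion to be transposed and compared with the other,
   whatever the value of [psi 1]. *)
have psi_tr : (map_mx psi 1%:M)^T = map_mx psi 1%:M :> 'M[C]_d.
  by rewrite map_trmx trmx1.
have := psiMM u (map_mx star u)^T.
have := psiMM (map_mx star u) u^T.
rewrite starstar h1 h3 -!map_trmx map_counit_gen map_counit_star_gen trmx1.
rewrite !mulmx1 !mul1mx => psi3 psi1.
apply: (addrI (map_mx psi u + (map_mx psi (map_mx star u))^T)).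
rewrite -psi1 -psi_tr psi3 [LHS]linearD /= [(_ + _)^T]linearD /= trmx_mul !trmxK.
by rewrite [X in X + _]addrC.
Qed.

Lemma gram_generating_functional :
  W^bar *m W^T = V *m V^bar^T -> admits_generating_functional eta.
Proof.
move=> gram; have [gram1 gram2] := gram_starE.
set P : 'M[C]_d := - 2^-1 *: (V *m V^bar^T).
set v := tri_mx W^bar P U V.
have hv : biunitary v.
  apply: tri_mx_biunitary => //; [exact: rho_unitary|exact: cocycle_relations|].
  by rewrite -gram1 gram.
(* With [x = rho b], [y = eta (star a)], [z = eta (star b)], [w = counit a], this matches the upper
   middle entry of a product in [tri3M]. *)
have conj_cocycle (x y z w : C^o) :
    (star x * y + z * star w)^* = w * z^* + y^* * x.
  change ((x^* * y + z * w^*)^* = w * z^* + y^* * x :> C).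
  by rewrite rmorphD !rmorphM /= !conjCK addrC mulrC [X in _ + X]mulrC.
(* Only the corner is left unspecified; induction determines the other entries, and the corner is
   then taken as [psi]. *)
have evE a : exists p, polU_eval v a =
    tri3 (counit C d a) (eta (star a))^* p (rho a) (eta a).
  elim/polU_ind: a => [j k|c|a b [p av] [q bv]|a b [p av] [q bv]|a [p av]].
  - by exists (P j k); rewrite (polU_eval_gen hv) mxE counit_gen !mxE.
  - exists 0; rewrite [LHS](polU_eval_scale hv) [polU_eval _ _](polU_eval_const hv).
    rewrite scale1r -tri3_scalar starZ star1 !linearZ_LR !rmorph1 cocycle1.
    by rewrite !scaler0 conjC0 [c%:A]mulr1.
  - by exists (p + q); rewrite [LHS](polU_eval_add hv) av bv tri3D starD !raddfD.
  - eexists; rewrite [LHS](polU_eval_mul hv) av bv tri3M starM !eta_cocycle.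
    rewrite !rmorphM rho_star counit_star; congr (tri3 _ _ _ _ _).
    by rewrite conj_cocycle.
  - exists p^*; rewrite (polU_eval_star hv) av star_tri3 starK.
    by rewrite counit_star rho_star conjCK.
pose psi_fun a : C^o := polU_eval v a ord0 ord_max.
have psi_linear : linear psi_fun.
  by move=> c a b; rewrite /psi_fun (polU_eval_is_linear hv) !mxE.
pose psi : {linear polU -> C^o} :=
  HB.pack psi_fun (GRing.isLinear.Build C polU C^o *:%R psi_fun psi_linear).
exists psi => a b; have [p av] := evE a; have [q bv] := evE b.
have psiE x : psi x = polU_eval v x ord0 ord_max by [].
have tri3_corner e t m r c : @tri3 C e t m r c ord0 ord_max = m by rewrite mxE.
(* The corner of the product is the required identity up to the order of its summands. *)
rewrite !psiE (polU_eval_mul hv) av bv tri3M !tri3_corner.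
by rewrite [LHS]addrC addrA.
Qed.

Lemma admits_generating_functionalP :
  admits_generating_functional eta <-> W^bar *m W^T = V *m V^bar^T.
Proof.
by split; [exact: generating_functional_gram | exact: gram_generating_functional].
Qed.

End Cocycles.

Theorem corollary3p4 (R : realType) (d : nat) :
  (forall (rho : {lrmorphism polU R[i] d -> R[i]^o})
          (eta : {linear polU R[i] d -> R[i]^o}),
     star_morphism rho -> cocycle rho eta ->
     let V : 'M[R[i]]_d := \matrix_(j, k) eta (polU_gen R[i] d j k) in
     let W : 'M[R[i]]_d := \matrix_(j, k) eta (star (polU_gen R[i] d j k)) in
     admits_generating_functional eta <->
       map_mx Num.conj W *m W^T = V *m (map_mx Num.conj V)^T)
  /\
  (forall eta : {linear polU R[i] d -> R[i]^o},
     gaussian_cocycle eta ->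
     let V : 'M[R[i]]_d := \matrix_(j, k) eta (polU_gen R[i] d j k) in
     admits_generating_functional eta <->
       V *m (map_mx Num.conj V)^T = (map_mx Num.conj V)^T *m V).
Proof.
have VE (eta : {linear polU R[i] d -> R[i]^o}) :
    \matrix_(j, k) eta (polU_gen R[i] d j k) = map_mx eta (polU_gen R[i] d).
  by apply/matrixP => j k; rewrite [LHS]mxE [RHS]mxE.
have WE (eta : {linear polU R[i] d -> R[i]^o}) :
    \matrix_(j, k) eta (star (polU_gen R[i] d j k)) =
    map_mx eta (map_mx star (polU_gen R[i] d)).
  by apply/matrixP => j k; rewrite [LHS]mxE [RHS]mxE [in RHS]mxE.
split=> [rho eta rho_star eta_cocycle|eta eta_gaussian].
  by rewrite VE WE; exact: admits_generating_functionalP _ _ _ _ rho_star eta_cocycle.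
rewrite VE => V; have counitS := @counit_star R[i] d.
rewrite (admits_generating_functionalP _ _ _ _ counitS eta_gaussian).
(* Here [rho] is the counit, and [W] is eliminated in favour of [V]. *)
have [-> _] := gram_starE _ _ _ _ counitS eta_gaussian.
by split=> ->.
Qed.
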